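(* Let $G=\left\{\begin{pmatrix} a&b\\0&a^{-1}\end{pmatrix}: a>0,\ b\in\mathbb R\right\}$, let $q\in\mathbb R$, and let $D:G\to G$ be the crossed homomorphism with respect to the conjugation action given by $$D\begin{pmatrix} a&b\\0&a^{-1}\end{pmatrix}=\begin{pmatrix}a^{-1}&-b+qa\ln a\\0&a\end{pmatrix}.$$ Let $\mathcal D:G\times\mathbb R\to G$ be a deformation of $D$, and let $\epsilon>0$ and a smooth function $f:(-\epsilon,\epsilon)\to\mathbb R$ with $f(0)=q$ be such that $$\mathcal D\left(\begin{pmatrix} a&b\\0&a^{-1}\end{pmatrix},s\right)=\begin{pmatrix}a^{-1}&-b+f(s)a\ln a\\0&a\end{pmatrix}\quad\text{for all }\begin{pmatrix} a&b\\0&a^{-1}\end{pmatrix}\in G,\ s\in(-\epsilon,\epsilon).$$ Assume that $f$ is not identically zero on any open interval $I\subset(-\epsilon,\epsilon)$. If $q=f(0)\neq0$, then the deformation $\mathcal D$ is trivial. If $q=f(0)=0$, then the deformation $\mathcal D$ is nontrivial.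
   Context: A crossed homomorphism with respect to the conjugation action on a Lie group $G$ is a smooth map $D:G\to G$ satisfying $D(xy)=D(x)\,x\,D(y)\,x^{-1}$ for all $x,y\in G$. A deformation of $D$ is a smooth map $\mathcal D:G\times\mathbb R\to G$ such that $\mathcal D(\cdot,0)=D$ and $\mathcal D(\cdot,t)$ is such a crossed homomorphism for every $t\in\mathbb R$. It is trivial if there are an interval $I=(-\varepsilon,\varepsilon)\subset\mathbb R$ and a smooth map $\tau:I\to G$ with $\tau(0)$ the identity and $\mathcal D(x,t)=\tau(t)\,D(x)\,x\,\tau(t)^{-1}\,x^{-1}$ for all $x\in G$, $t\in I$; it is nontrivial if it is not trivial. *)

(* Defs.v *)
From HB Require Import structures.
From mathcomp Require Import all_boot all_order all_algebra.
From mathcomp Require Import all_classical all_reals all_analysis.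

Set Implicit Arguments.
Unset Strict Implicit.
Unset Printing Implicit Defensive.

Import Order.TTheory GRing.Theory Num.Theory numFieldNormedType.Exports.
Local Open Scope classical_set_scope.
Local Open Scope ring_scope.

(* [Ck n U f] is meant for open [U]; neither continuity nor differentiability
   at points of an open set depends on the values of [f] outside it. *)
Fixpoint Ck (R : realType) (V W : normedModType R) (n : nat) (U : set V)
    (f : V -> W) : Prop :=
  (forall x, U x -> {for x, continuous f}) /\
  (if n is m.+1 then
     forall v : V, (forall x, U x -> derivable f x v) /\ Ck m U ('D_v f)
   else True).

Definition smooth_on (R : realType) (V W : normedModType R) (U : set V)
    (f : V -> W) : Prop :=
  forall n, Ck n U f.

Section Group.
Variable R : realType.

Definition umx (a b : R) : 'M[R]_2 :=
  \matrix_(i < 2, j < 2)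
    if i == 0 then (if j == 0 then a else b)
    else (if j == 0 then 0 else a^-1).

Definition is_umx : pred 'M[R]_2 :=
  fun A => (0 < A 0 0) && (A == umx (A 0 0) (A 0 1)).

Record ut2 := UT2 { ut2_mx :> 'M[R]_2; _ : is_umx ut2_mx }.

HB.instance Definition _ := [isSub for ut2_mx].
HB.instance Definition _ := [Choice of ut2 by <:].

Lemma is_umxE a b : is_umx (umx a b) = (0 < a).
Proof. by rewrite /is_umx !mxE /= eqxx andbT. Qed.

Lemma is_umxP A : reflect (exists2 a, 0 < a & exists b, A = umx a b) (is_umx A).
Proof.
apply: (iffP idP) => [/andP[a0 /eqP ->]|[a a0 [b ->]]]; last by rewrite is_umxE.
by exists (A 0 0) => //; exists (A 0 1).
Qed.

Lemma umx_mul a b c d :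
  umx a b *m umx c d = umx (a * c) (a * d + b * c^-1).
Proof.
apply/matrixP => i j; rewrite !mxE !big_ord_recl big_ord0 !mxE /=.
case: i => [[|[|//]] ?] /=; case: j => [[|[|//]] ?] /=;
  by rewrite ?(mul0r, mulr0, addr0, add0r) // invfM.
Qed.

Lemma umx1 : umx 1 0 = 1%:M.
Proof.
apply/matrixP => i j; rewrite !mxE /=.
by case: i => [[|[|//]] ?] /=; case: j => [[|[|//]] ?] /=; rewrite ?invr1.
Qed.

Lemma umx_unit a b : 0 < a -> umx a b \in unitmx.
Proof.
move=> a0; have := umx_mul a b a^-1 (- b).
by rewrite mulfV ?gt_eqF// invrK mulrN mulrC addNr umx1 => /mulmx1_unit[].
Qed.

Lemma umx_inv a b : 0 < a -> invmx (umx a b) = umx a^-1 (- b).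
Proof.
move=> a0; apply: (can_inj (mulKmx (umx_unit b a0))).
rewrite mulmxV ?umx_unit// umx_mul mulfV ?gt_eqF// invrK mulrN mulrC addNr.
by rewrite umx1.
Qed.

Lemma is_umx1 : is_umx 1%:M.
Proof. by rewrite -umx1 is_umxE. Qed.

Lemma is_umxM (x y : ut2) : is_umx (ut2_mx x *m ut2_mx y).
Proof.
case: x y => _ /= /is_umxP[a a0 [b ->]] [_ /= /is_umxP[c c0 [d ->]]].
by rewrite umx_mul is_umxE mulr_gt0.
Qed.

Lemma is_umxV (x : ut2) : is_umx (invmx (ut2_mx x)).
Proof.
by case: x => _ /= /is_umxP[a a0 [b ->]]; rewrite umx_inv// is_umxE invr_gt0.
Qed.

Lemma ut2_unit (x : ut2) : ut2_mx x \in unitmx.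
Proof. by case: x => _ /= /is_umxP[a a0 [b ->]]; rewrite umx_unit. Qed.

Definition ut2_one : ut2 := UT2 is_umx1.
Definition ut2_mul (x y : ut2) : ut2 := UT2 (is_umxM x y).
Definition ut2_inv (x : ut2) : ut2 := UT2 (is_umxV x).

Fact ut2_mulA : associative ut2_mul.
Proof. by move=> x y z; apply: val_inj; exact: mulmxA. Qed.

Fact ut2_mul1 : left_id ut2_one ut2_mul.
Proof. by move=> x; apply: val_inj; exact: mul1mx. Qed.

Fact ut2_1mul : right_id ut2_one ut2_mul.
Proof. by move=> x; apply: val_inj; exact: mulmx1. Qed.

Fact ut2_mulV : left_inverse ut2_one ut2_inv ut2_mul.
Proof. by move=> x; apply: val_inj; apply: mulVmx; exact: ut2_unit. Qed.

Fact ut2_Vmul : right_inverse ut2_one ut2_inv ut2_mul.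
Proof. by move=> x; apply: val_inj; apply: mulmxV; exact: ut2_unit. Qed.

HB.instance Definition _ :=
  isGroup.Build ut2 ut2_mulA ut2_mul1 ut2_1mul ut2_mulV ut2_Vmul.

(* The group element with matrix [umx a b]; the junk value 1 if [a <= 0]. *)
Definition ut (a b : R) : ut2 := insubd (1%g : ut2) (umx a b).

Lemma utE a b : 0 < a -> ut2_mx (ut a b) = umx a b.
Proof. by move=> a0; rewrite -[LHS]/(val _) insubdK// /in_mem /= is_umxE. Qed.

(* The manifold structure of the group is given by the single global chart
   [ut_chart], a bijection onto the half-plane [half_plane] with inverse
   [p |-> ut p.1 p.2]; smoothness is smoothness of the chart expressions. *)
Definition half_plane : set (R * R) := [set p | 0 < p.1].

Definition ut_chart (x : ut2) : R * R := (x 0 0, x 0 1).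

Lemma ut_chartK (x : ut2) : ut (ut_chart x).1 (ut_chart x).2 = x.
Proof.
apply: val_inj; case: x => A /= /[dup] HA /andP[a0 /eqP Ae].
by rewrite /ut_chart /= [LHS]utE// -Ae.
Qed.

Lemma utK (p : R * R) : half_plane p -> ut_chart (ut p.1 p.2) = p.
Proof. by case: p => a b a0; rewrite /ut_chart utE// !mxE. Qed.

Definition smooth_endo (F : ut2 -> ut2) : Prop :=
  smooth_on half_plane (fun p : R * R => ut_chart (F (ut p.1 p.2))).

Definition smooth_family (F : ut2 * R -> ut2) : Prop :=
  smooth_on (half_plane `*` [set: R])
    (fun p : R * R * R => ut_chart (F (ut p.1.1 p.1.2, p.2))).

Definition smooth_curve (I : set R) (tau : R -> ut2) : Prop :=
  smooth_on I (fun t : R => ut_chart (tau t)).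

Definition crossed_hom (D : ut2 -> ut2) : Prop :=
  smooth_endo D /\
  (forall x y : ut2, D (x * y) = D x * x * D y * x^-1)%g.

Definition deformation (D : ut2 -> ut2) (DD : ut2 * R -> ut2) : Prop :=
  [/\ smooth_family DD,
      forall x, DD (x, 0) = D x
    & forall t, crossed_hom (fun x => DD (x, t))].

(* A map on the interval is represented by a map on [R] whose values outside
   the interval are irrelevant. *)
Definition trivial_deformation (D : ut2 -> ut2) (DD : ut2 * R -> ut2) : Prop :=
  exists e : R, 0 < e /\
  exists tau : R -> ut2,
    [/\ smooth_curve `]- e, e[ tau,
        tau 0 = 1%g
      & forall (x : ut2) (t : R), t \in `]- e, e[ ->
          DD (x, t) = (tau t * D x * x * (tau t)^-1 * x^-1)%g].

Definition nontrivial_deformation (D : ut2 -> ut2) (DD : ut2 * R -> ut2) :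
  Prop := ~ trivial_deformation D DD.

End Group.

(* Main.v *)
Require Import Defs.
From mathcomp Require Import all_boot all_order all_algebra.
From mathcomp Require Import all_classical all_reals all_analysis.
From mathcomp Require Import ring.
Import Order.TTheory GRing.Theory Num.Theory numFieldNormedType.Exports.
Local Open Scope classical_set_scope.
Local Open Scope ring_scope.

(** Write [x = ut a b].  Conjugating the cocycle [D] by [ut c d] gives
    [ut c d * D x * x * (ut c d)^-1 * x^-1 = ut a^-1 (- b + c^2 q a ln a)]
    ([gauge_ut]): the translation part [d] cancels, because [D x * x] lies in
    the abelian subgroup of unipotent matrices, on which [ut c d] acts by
    scaling by [c^2].  So a curve [tau] with diagonal entry [c t] trivialises
    the deformation exactly when [f t = c(t)^2 q].

    If [q != 0], then [f / q] is 1 at 0, hence positive near 0, and the curve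
    with [c = sqrt (f / q)] and [d = 0] works.  Its smoothness is the analytic
    content: it is the case [p = 1/2] of [Ck_powR], that a real power of a
    positive C^k function is C^k.

    If [q = 0], a trivialisation would force [f = 0] on a whole interval around
    0, which is excluded. *)

(** On an open set derivatives are local, so equality on the set alone lets
    every iterated derivative be replaced. *)
Lemma Ck_ext {R : realType} {V W : normedModType R} (n : nat) (U : set V)
    (f g : V -> W) :
  open U -> (forall x, U x -> f x = g x) -> Ck n U f -> Ck n U g.
Proof.
move=> oU; elim: n f g => [|n IH] f g fg Cf;
  have near_fg x : U x -> \forall y \near x, f y = g y by
    move=> Ux; apply: filterS (open_nbhs_nbhs (conj oU Ux)) => y; exact: fg.
- split=> // x Ux; rewrite /prop_for /continuous_at -(fg x Ux).
  by apply: cvg_trans (Cf.1 x Ux); apply: near_eq_cvg; exact: near_fg.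
- split=> [x Ux|v].
    rewrite /prop_for /continuous_at -(fg x Ux).
    by apply: cvg_trans (Cf.1 x Ux); apply: near_eq_cvg; exact: near_fg.
  have [fv Dv] := Cf.2 v; split.
    by move=> x Ux; apply: near_eq_derivable (fv x Ux); exact: near_fg.
  by apply: IH Dv => x Ux; apply: near_eq_derive; exact: near_fg.
Qed.

Lemma Ck_subset {R : realType} {V W : normedModType R} (n : nat) (U U' : set V)
    (f : V -> W) :
  U' `<=` U -> Ck n U f -> Ck n U' f.
Proof.
move=> UU'; elim: n f => [|n IH] f [fc fD]; split=> //.
- by move=> x /UU'; exact: fc.
- by move=> x /UU'; exact: fc.
- move=> v; have [fv Dv] := fD v; split; last exact: IH.
  by move=> x /UU'; exact: fv.
Qed.

Lemma Ck_leS {R : realType} {V W : normedModType R} (n : nat) (U : set V)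
    (f : V -> W) : Ck n.+1 U f -> Ck n U f.
Proof.
elim: n f => [|n IH] f [fc fD]; split=> // v.
by have [fv Dv] := fD v; split=> //; exact: IH.
Qed.

(** The inductive step of all closure properties below: a formula for the
    derivative valid on [U] only suffices, since it can then be traded for
    ['D_v f] by [Ck_ext]. *)
Lemma Ck_is_derive {R : realType} {V W : normedModType R} (n : nat) (U : set V)
    (f : V -> W) (df : V -> V -> W) :
  open U -> (forall x, U x -> {for x, continuous f}) ->
  (forall v x, U x -> is_derive x v f (df v x)) ->
  (forall v, Ck n U (df v)) -> Ck n.+1 U f.
Proof.
move=> oU fc fdf Cdf; split=> // v; split.
  by move=> x Ux; have [] := fdf v x Ux.
by apply: Ck_ext (Cdf v) => // x Ux; have [] := fdf v x Ux.
Qed.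

Lemma Ck_cst {R : realType} {V W : normedModType R} (n : nat) (U : set V)
    (c : W) : open U -> Ck n U (cst c : V -> W).
Proof.
move=> oU; elim: n c => [|n IH] c.
  by split=> // x _; exact: cst_continuous.
apply: (@Ck_is_derive _ _ _ _ _ _ (fun _ => cst 0)) => //.
by move=> x _; exact: cst_continuous.
Qed.

Lemma CkD {R : realType} {V W : normedModType R} (n : nat) (U : set V)
    (f g : V -> W) : open U -> Ck n U f -> Ck n U g -> Ck n U (f + g).
Proof.
move=> oU; elim: n f g => [|n IH] f g [fc fD] [gc gD].
  by split=> // x Ux; apply: continuousD; [exact: fc|exact: gc].
apply: (@Ck_is_derive _ _ _ _ _ _ (fun v => 'D_v f + 'D_v g)) => //.
- by move=> x Ux; apply: continuousD; [exact: fc|exact: gc].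
- move=> v x Ux; have [fv _] := fD v; have [gv _] := gD v.
  by apply: is_deriveD; apply: derivableP; [exact: fv|exact: gv].
- by move=> v; have [_ fv] := fD v; have [_ gv] := gD v; exact: IH.
Qed.

Lemma CkM {R : realType} {V : normedModType R} (n : nat) (U : set V)
    (f g : V -> R) : open U -> Ck n U f -> Ck n U g -> Ck n U (f * g).
Proof.
move=> oU; elim: n f g => [|n IH] f g Cf Cg.
  by split=> // x Ux; apply: continuousM; [exact: Cf.1|exact: Cg.1].
have [fc fD] := Cf; have [gc gD] := Cg.
apply: (@Ck_is_derive _ _ _ _ _ _ (fun v => f * 'D_v g + g * 'D_v f)) => //.
- by move=> x Ux; apply: continuousM; [exact: fc|exact: gc].
- move=> v x Ux; have [fv _] := fD v; have [gv _] := gD v.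
  by apply: is_deriveM; apply: derivableP; [exact: fv|exact: gv].
- move=> v; have [_ fv] := fD v; have [_ gv] := gD v.
  by apply: CkD => //; apply: IH => //; exact: Ck_leS.
Qed.

Lemma is_derive_pair {R : realType} {V W W' : normedModType R} (f : V -> W)
    (g : V -> W') (x v : V) (df : W) (dg : W') :
  is_derive x v f df -> is_derive x v g dg ->
  is_derive x v (fun y => (f y, g y)) (df, dg).
Proof.
move=> [fv fE] [gv gE].
have fgv : h^-1 *: (((fun y => (f y, g y)) \o shift x) (h *: v)
    - (f x, g x)) @[h --> 0^'] --> (df, dg).
  by apply: cvg_pair; [rewrite -fE|rewrite -gE].
by split; [apply/cvg_ex; exists (df, dg)|exact: cvg_lim].
Qed.

Lemma Ck_pair {R : realType} {V W W' : normedModType R} (n : nat) (U : set V)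
    (f : V -> W) (g : V -> W') :
  open U -> Ck n U f -> Ck n U g -> Ck n U (fun x => (f x, g x)).
Proof.
move=> oU; elim: n f g => [|n IH] f g [fc fD] [gc gD].
  by split=> // x Ux; apply: cvg_pair; [exact: fc|exact: gc].
apply: (@Ck_is_derive _ _ _ _ _ _ (fun v x => ('D_v f x, 'D_v g x))) => //.
- by move=> x Ux; apply: cvg_pair; [exact: fc|exact: gc].
- move=> v x Ux; have [fv _] := fD v; have [gv _] := gD v.
  by apply: is_derive_pair; apply: derivableP; [exact: fv|exact: gv].
- by move=> v; have [_ fv] := fD v; have [_ gv] := gD v; exact: IH.
Qed.

(** A directional derivative is an ordinary derivative along a line, which
    brings the one-variable chain rule to functions on any normed space. *)
Lemma is_derive_line {R : realType} {V W : normedModType R} (f : V -> W)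
    (x v : V) (df : W) :
  is_derive x v f df <-> is_derive (0 : R) (1 : R) (fun h => f (h *: v + x)) df.
Proof.
have E : (fun h => h^-1 *: (((fun h => f (h *: v + x)) \o shift (0 : R)) (h *: 1)
           - f ((0 : R) *: v + x)))
       = (fun h => h^-1 *: ((f \o shift x) (h *: v) - f x)).
  by apply/funext => h /=; rewrite addr0 scale0r add0r [h *: 1]mulr1.
by split=> -[fv fE]; split; move: fv fE; rewrite /derivable /derive E.
Qed.

Lemma is_derive_comp1 {R : realType} {V : normedModType R} (f : R -> R)
    (g : V -> R) (x v : V) (a b : R) :
  is_derive (g x) 1 f a -> is_derive x v g b -> is_derive x v (f \o g) (a * b).
Proof.
move=> fa /is_derive_line gb; apply/is_derive_line.
by apply: (@is_derive1_comp _ f (fun h => g (h *: v + x)));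
  rewrite ?scale0r ?add0r.
Qed.

(** The family of all real powers is stable under differentiation up to factors
    of the right regularity: the derivative of [g ^ p] is
    [p * g ^ (p - 1) * g'].  Quantifying over the exponent inside the induction
    therefore closes it at once, which the square root alone would not. *)
Lemma Ck_powR {R : realType} {V : normedModType R} (n : nat) (U : set V)
    (g : V -> R) (p : R) :
  open U -> (forall x, U x -> 0 < g x) -> Ck n U g ->
  Ck n U (fun x => g x `^ p).
Proof.
move=> oU g0.
have gpc m q : Ck m U g ->
    forall x, U x -> {for x, continuous (fun x => g x `^ q)}.
  move=> Cg x Ux.
  have gc : {for x, continuous g} by case: m Cg => [|m] [+ _]; exact.
  apply: (@continuous_comp _ _ _ g (fun y => y `^ q)) => //.
  apply: differentiable_continuous; apply/derivable1_diffP.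
  by apply: derivable_powR; rewrite in_itv /= andbT; exact: g0.
elim: n p => [|n IH] p Cg; first by split=> //; exact: (gpc 0%N).
apply: (@Ck_is_derive _ _ _ _ _ _
  (fun v => (cst p * (fun x => g x `^ (p - 1))) * 'D_v g)) => //.
- exact: (gpc n.+1).
- move=> v x Ux; apply: (@is_derive_comp1 _ _ (fun y => y `^ p) g).
    exact: is_derive1_powR (g0 x Ux).
  by apply: derivableP; exact: (Cg.2 v).1.
- move=> v; apply: CkM => //; last exact: (Cg.2 v).2.
  by apply: CkM => //; [exact: Ck_cst|apply: IH; exact: Ck_leS].
Qed.

Lemma utM {R : realType} (a b c d : R) : 0 < a -> 0 < c ->
  (ut a b * ut c d)%g = ut (a * c) (a * d + b * c^-1).
Proof.
move=> a0 c0; apply: val_inj => /=.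
by rewrite !utE ?mulr_gt0// umx_mul.
Qed.

Lemma utV {R : realType} (a b : R) : 0 < a -> ((ut a b)^-1)%g = ut a^-1 (- b).
Proof. by move=> a0; apply: val_inj => /=; rewrite !utE ?invr_gt0// umx_inv. Qed.

Lemma ut1 {R : realType} : ut 1 0 = 1%g :> ut2 R.
Proof. by apply: val_inj => /=; rewrite utE ?umx1. Qed.

Lemma ut_inj {R : realType} (a b c d : R) : 0 < a -> 0 < c ->
  ut a b = ut c d -> a = c /\ b = d.
Proof.
move=> a0 c0 /(congr1 (@ut_chart R)).
by rewrite (@utK _ (a, b))// (@utK _ (c, d))// => -[-> ->].
Qed.

Lemma ut2P {R : realType} (x : ut2 R) : exists a b : R, 0 < a /\ x = ut a b.
Proof.
case: x => A HA; have /is_umxP[a a0 [b E]] := HA.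
by exists a, b; split=> //; apply: val_inj; rewrite /= utE.
Qed.

(** [D x * x] is the unipotent element [ut 1 (q * ln a)]; conjugation by
    [ut c d] multiplies its off-diagonal entry by [c ^+ 2], whatever [d] is. *)
Lemma gauge_ut {R : realType} (q a b c d : R) : 0 < a -> 0 < c ->
  (ut c d * ut a^-1 (- b + q * a * ln a) * ut a b * (ut c d)^-1
     * (ut a b)^-1)%g
  = ut a^-1 (- b + c ^+ 2 * q * a * ln a).
Proof.
move=> a0 c0; rewrite !utV// !utM ?(mulr_gt0, invr_gt0)//.
have an0 : a != 0 by rewrite gt_eqF.
have cn0 : c != 0 by rewrite gt_eqF.
by congr ut; field; rewrite ?an0 ?cn0.
Qed.

Theorem theorem4p3 (R : realType) (q : R) (D : ut2 R -> ut2 R)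
  (D_crossed : crossed_hom D)
  (D_def : forall a b : R, 0 < a ->
     D (ut a b) = ut a^-1 (- b + q * a * ln a))
  (DD : ut2 R * R -> ut2 R) (DD_deform : deformation D DD)
  (eps : R) (eps_gt0 : 0 < eps)
  (f : R -> R) (f_smooth : smooth_on `]- eps, eps[ f) (f0 : f 0 = q)
  (DD_def : forall a b s : R, 0 < a -> s \in `]- eps, eps[ ->
     DD (ut a b, s) = ut a^-1 (- b + f s * a * ln a))
  (f_nonzero : forall u v : R, u < v -> `]u, v[ `<=` `]- eps, eps[ ->
     exists2 s, s \in `]u, v[ & f s != 0) :
  (q != 0 -> trivial_deformation D DD) /\
  (q = 0 -> nontrivial_deformation D DD).
Proof.
split=> [q0|q0].
- pose g : R -> R := cst q^-1 * f.
  have gE t : g t = q^-1 * f t by [].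
  have g0 : g 0 = 1 by rewrite gE f0 mulVf.
  (* the square root of [g] is smooth only where [g] is positive *)
  have [e [e0 e_eps ge]] : exists e : R,
      [/\ 0 < e, e <= eps & forall t, t \in `]- e, e[ -> 0 < g t].
    have gc : {for 0, continuous g}.
      apply: continuousM; first exact: cst_continuous.
      by apply: (f_smooth 0%N).1; rewrite /= in_itv /= oppr_lt0 eps_gt0.
    have : \forall t \near (0 : R), 0 < g t.
      by apply: (cvgr_gt (g 0) gc); rewrite g0.
    move=> /nbhs_ballP[r /= r0 rg].
    exists (Num.min r eps); split; first by rewrite lt_min r0.
      by rewrite ge_min lexx orbT.
    move=> t tr; apply: rg; rewrite /ball /= sub0r normrN.
    by move: tr; rewrite in_itv /= -ltr_norml lt_min => /andP[].
  exists e; split=> //.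
  exists (fun t => ut (g t `^ 2^-1) 0); split.
  + move=> n; apply: (@Ck_ext _ _ _ _ _ (fun t => (g t `^ 2^-1, 0))).
    * exact: interval_open.
    * by move=> t te; rewrite (@utK _ (_, _))//; apply: powR_gt0; exact: ge.
    * apply: Ck_pair; [exact: interval_open| |apply: Ck_cst; exact: interval_open].
      apply: Ck_powR; [exact: interval_open|exact: ge|].
      apply: CkM; [exact: interval_open|apply: Ck_cst; exact: interval_open|].
      apply: Ck_subset (f_smooth n) => t /=; rewrite !in_itv /= => /andP[te1 te2].
      by rewrite (le_lt_trans _ te1) ?lerN2// (lt_le_trans te2).
  + by rewrite g0 powR1 ut1.
  + move=> x t te; have [a [b [a0 ->]]] := ut2P x.
    rewrite DD_def//; last first.
      move: te; rewrite !in_itv /= => /andP[te1 te2].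
      by rewrite (le_lt_trans _ te1) ?lerN2// (lt_le_trans te2).
    rewrite D_def// gauge_ut ?powR_gt0 ?ge//.
    rewrite powR12_sqrt ?sqr_sqrtr ?ltW ?ge//.
    by rewrite gE [q^-1 * f t * q]mulrAC mulVf// mul1r.
- case=> e [e0 [tau [_ _ tauE]]].
  pose r := Num.min e eps.
  have r0 : 0 < r by rewrite lt_min e0.
  have rsub u : r <= u -> forall s, s \in `]- r, r[ -> s \in `]- u, u[.
    move=> ru s; rewrite !in_itv /= => /andP[s1 s2].
    by rewrite (le_lt_trans _ s1) ?lerN2// (lt_le_trans s2).
  have [||s sr /eqP] := f_nonzero (- r) r; first by rewrite gtrN.
    by apply: rsub; rewrite /r ge_min lexx orbT.
  apply.
  have /(rsub e) se := sr; have /(rsub eps) seps := sr.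
  (* at [a = expR 1], [ln a] is 1, so the off-diagonal entry detects [f s] *)
  have := tauE (ut (expR 1) 0) s (se _).
  rewrite /r ge_min lexx => /(_ isT).
  have a0 : 0 < expR (1 : R) by exact: expR_gt0.
  rewrite DD_def ?seps ?ge_min ?lexx ?orbT// D_def//.
  have [c [d [c0 ->]]] := ut2P (tau s).
  rewrite gauge_ut// q0 => /ut_inj [||_]; rewrite ?invr_gt0//.
  by rewrite expRK oppr0 !add0r !mulr1 mulr0 mul0r => /eqP;
    rewrite mulf_eq0 (gt_eqF a0) orbF => /eqP.
Qed.
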